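(* Let $\alpha,\beta>0$ be rationally independent real numbers, and let $p,q$ be two positive coprime integers. For any $\varepsilon>0$ there is a measurable function $f:\mathbb{R}\to\mathbb{C}$ satisfying $$\sum_{k\in\mathbb{Z}} f(x-k\alpha)=p,\qquad \sum_{k\in\mathbb{Z}} f(x-k\beta)=q\qquad\text{for a.e. } x\in\mathbb{R},$$ with both series converging absolutely for a.e. $x$, and such that $$\operatorname{mes}(\operatorname{supp} f)<\alpha+\beta-\min\Big\{\frac{\alpha}{q},\frac{\beta}{p}\Big\}+\varepsilon.$$
   Context: Two positive real numbers $\alpha,\beta$ are rationally independent if $n\alpha+m\beta=0$ with $n,m\in\mathbb{Z}$ implies $n=m=0$ (equivalently, $\alpha/\beta$ is irrational). The support of a function $f$ is the set $\operatorname{supp} f=\{x: f(x)\ne 0\}$ (no closure is taken). $\operatorname{mes}$ denotes Lebesgue measure on $\mathbb{R}$. *)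

(* Defs.v *)
From mathcomp Require Import all_boot all_order all_algebra.
From mathcomp Require Import all_classical all_reals all_analysis.
From mathcomp Require Import complex.
From mathcomp Require summability.
Set Implicit Arguments.
Unset Strict Implicit.
Unset Printing Implicit Defensive.
Import Order.TTheory GRing.Theory Num.Theory numFieldNormedType.Exports.
Local Open Scope classical_set_scope.
Local Open Scope ring_scope.
Local Open Scope complex_scope.

Definition rationally_independent (R : realType) (a b : R) : Prop :=
  forall n m : int, n%:~R * a + m%:~R * b = 0 -> n = 0 /\ m = 0.

(* The real line with its Lebesgue (Caratheodory, i.e. completed Borel)
   sigma-algebra, on which [completed_lebesgue_measure] is defined; it is
   convertible to [R]. *)
Definition lebesgueType (R : realType) :=
  caratheodory_type (mu_ext (@wlength R idfun)).

Definition mes (R : realType) : {measure set (lebesgueType R) -> \bar R} :=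
  @completed_lebesgue_measure R.

(* The complex plane with its Borel sigma-algebra; the canonical topology of
   [R[i]] is carried by the alias [R[i]^o]. *)
Definition borelC (R : realType) := g_sigma_algebraType (@open R[i]^o).

Definition lebesgue_measurable_fun (R : realType) (f : R -> R[i]) : Prop :=
  measurable_fun [set: lebesgueType R] (f : lebesgueType R -> borelC R).

Definition supp (R : realType) (f : R -> R[i]) : set R := [set x | f x != 0].

Definition abs_cvg (R : realType) (u : int -> R[i]) : Prop :=
  summable [set: int] (fun k => (ComplexField.Normc.normc (u k))%:E).

(* [s] is the sum of the family [u] over [int]: the limit of the sums of [u] over
   the finite subsets of [int], ordered by inclusion.  When [u] is absolutely
   convergent, it is also the limit of the sums over [-N <= k <= N]. *)
Definition has_sum (R : realType) (u : int -> R[i]) (s : R[i]) : Prop :=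
  summability.partial_sum (u : int -> R[i]^o) @ summability.totally
    --> (s : R[i]^o).

(* Main.v *)
Require Import Defs.
From mathcomp Require Import all_boot all_order all_algebra.
From mathcomp Require Import all_classical all_reals all_analysis.
From mathcomp Require Import complex.
From mathcomp Require Import measurable_realfun finmap zify ring lra.
Import Order.TTheory GRing.Theory Num.Theory numFieldNormedType.Exports.
Local Open Scope classical_set_scope.
Local Open Scope ring_scope.
Local Open Scope complex_scope.
Set Implicit Arguments.
Unset Strict Implicit.
Unset Printing Implicit Defensive.

(* Identify a point [x] with an edge joining its class in R/aZ to its class in
   R/bZ: the two tiling conditions prescribe the sum of [f] over the edges at
   every vertex, [p] on one side and [q] on the other.

   A staircase tree with [q] vertices in R/aZ, [p] in R/bZ and only [p + q - 1]
   edges satisfies the prescription exactly.  By density of aZ + bZ, a copy of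
   it indexed by an interval of length [l], for any [l < min (a / q) (b / p)],
   embeds in the line; it uses up measure [q l] of R/aZ and [p l] of R/bZ.

   The remaining prescriptions [g] on R/aZ and [h] on R/bZ are met at the cost
   of one edge per vertex plus an arbitrarily small excess: satisfy [g] along
   edges whose other ends all lie in a tiny interval of R/bZ, then the modified
   [h] along edges ending in a still tinier interval of R/aZ, and so on.  The
   intervals being open at 0 and shrinking to 0, every vertex is eventually left
   alone, so all the sums are finite. *)

(** * Sums of families with finitely many nonzero terms *)

(** Stated as eventual constancy of the partial sums along finite sets: additivity needs only a
    union of two sets, and finiteness of the support comes for free. *)
Definition fin_sum (V : zmodType) (I : choiceType) (F : I -> V) (s : V) : Prop :=
  exists A : {fset I}, forall B : {fset I}, (A `<=` B)%fset ->
    \sum_(i <- B) F i = s.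

Section FinSum.
Variables (V : zmodType) (I : choiceType).
Implicit Types (F G : I -> V) (s t : V).

Lemma fin_sumD F G s t :
  fin_sum F s -> fin_sum G t -> fin_sum (fun i => F i + G i) (s + t).
Proof.
move=> [A hA] [B hB]; exists (A `|` B)%fset => C; rewrite fsubUset => /andP[AC BC].
by rewrite big_split/= hA// hB.
Qed.

Lemma fin_sum_seq F (r : seq I) : uniq r -> (forall i, i \notin r -> F i = 0) ->
  fin_sum F (\sum_(i <- r) F i).
Proof.
move=> ur F0; exists [fset i in r]%fset => B rB.
rewrite (bigID (mem r))/= [X in _ + X]big1 ?addr0; last by move=> i /F0.
rewrite -big_filter; apply: perm_big; apply: uniq_perm => //.
  by rewrite filter_uniq// fset_uniq.
move=> i; rewrite mem_filter andb_idr// => ir.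
by apply: (fsubsetP rB); rewrite inE.
Qed.

Lemma fin_sum1 F i0 : (forall i, i != i0 -> F i = 0) -> fin_sum F (F i0).
Proof.
move=> F0; rewrite -[F i0](big_seq1 +%R i0 F).
by apply: fin_sum_seq => // i; rewrite inE => /F0.
Qed.

Lemma fin_sum0 F : (forall i, F i = 0) -> fin_sum F 0.
Proof.
by move=> F0; rewrite -[0](big_nil 0 +%R xpredT F); apply: fin_sum_seq => // i _.
Qed.

Lemma fin_sum_sum (J : Type) (r : seq J) (F : J -> I -> V) (s : J -> V) :
  (forall j, fin_sum (F j) (s j)) ->
  fin_sum (fun i => \sum_(j <- r) F j i) (\sum_(j <- r) s j).
Proof.
move=> Fs; elim: r => [|j r IH].
  by rewrite big_nil; apply: fin_sum0 => i; rewrite big_nil.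
rewrite big_cons; under eq_fun do rewrite big_cons; exact: fin_sumD.
Qed.

(** Adding one more index to the stabilizing set [A] leaves the sum unchanged, so the term added is
    zero. *)
Lemma fin_sum_finite_support F s : fin_sum F s ->
  exists A : {fset I}, forall i, i \notin A -> F i = 0.
Proof.
move=> [A hA]; exists A => i iA.
apply: (addIr (\sum_(j <- A) F j)).
by rewrite add0r -big_fsetU1//= hA ?hA// fsubsetUr.
Qed.

End FinSum.

(** * Tilings, periodic functions and reduction modulo a lattice *)

(** Required at every point and with finite sums, which is stronger than almost everywhere absolute
    convergence and turns every limit exchange into finite algebra. *)
Definition tiles (R : realType) (a : R) (f g : R -> R) : Prop :=
  forall x, fin_sum (fun k : int => f (x - k%:~R * a)) (g x).

Definition periodicz (R : realType) (a : R) (g : R -> R) : Prop :=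
  forall x (k : int), g (x + k%:~R * a) = g x.

(** For [a > 0], the representative in [0, a) of the class of [x] modulo [a Z]. *)
Definition fracpart (R : realType) (a x : R) : R := x - (Num.floor (x / a))%:~R * a.

(* The interval is open, so that every point lies outside
   [(0, d) + a Z] for all sufficiently small [d]. *)
Definition near_lattice (R : realType) (a d x : R) : Prop :=
  exists k : int, 0 < x - k%:~R * a < d.

Section Frac.
Variables (R : realType) (a : R).
Hypothesis a_gt0 : 0 < a.

Lemma fracpart_itv x : 0 <= fracpart a x < a.
Proof.
rewrite /fracpart; have /andP[h1 h2] := floor_itv (x / a).
rewrite subr_ge0 -ler_pdivlMr// h1/= ltrBlDr.
by move: h2; rewrite intrD ltr_pdivrMr// mulrDl mul1r addrC.
Qed.

Lemma fracpart_decomp x : x = fracpart a x + (Num.floor (x / a))%:~R * a.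
Proof. by rewrite /fracpart subrK. Qed.

Lemma floor_shift x (k : int) :
  Num.floor ((x + k%:~R * a) / a) = Num.floor (x / a) + k.
Proof. by rewrite mulrDl mulfK ?gt_eqF// floorDrz ?intrKfloor// intr_int. Qed.

Lemma floor_add r (k : int) : 0 <= r < a -> Num.floor ((r + k%:~R * a) / a) = k.
Proof.
move=> /andP[r0 ra]; rewrite floor_shift (_ : Num.floor _ = 0) ?add0r//.
by apply: floor_def; rewrite add0r divr_ge0 ?(ltW a_gt0)//= ltr_pdivrMr ?mul1r.
Qed.

Lemma fracpart_shift x (k : int) : fracpart a (x + k%:~R * a) = fracpart a x.
Proof. by rewrite /fracpart floor_shift intrD mulrDl opprD addrACA subrr addr0. Qed.

Lemma fracpart_id r : 0 <= r < a -> fracpart a r = r.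
Proof.
move=> hr; have := floor_add 0 hr.
by rewrite /fracpart mul0r addr0 => ->; rewrite mul0r subr0.
Qed.

Lemma near_lattice_fracpart d x : d <= a -> near_lattice a d x -> 0 < fracpart a x < d.
Proof.
move=> da [k /andP[h1 h2]].
have -> : fracpart a x = x - k%:~R * a.
  rewrite -(fracpart_shift x (- k)) intrN mulNr fracpart_id// (ltW h1)/=.
  exact: lt_le_trans da.
by rewrite h1 h2.
Qed.

Lemma near_lattice_shift d x (k : int) :
  near_lattice a d (x + k%:~R * a) -> near_lattice a d x.
Proof.
move=> [j h]; exists (j - k).
suff -> : x - (j - k)%:~R * a = x + k%:~R * a - j%:~R * a by [].
by rewrite intrB; ring.
Qed.

Lemma near_lattice_le d d' x : d <= d' -> near_lattice a d x -> near_lattice a d' x.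
Proof. by move=> dd' [j /andP[h1 h2]]; exists j; rewrite h1 (lt_le_trans h2). Qed.

Lemma measurable_floor : measurable_fun setT (fun x : R => (Num.floor x)%:~R : R).
Proof.
apply: nondecreasing_measurable => // x y xy.
by rewrite ler_int; exact: le_floor.
Qed.

Lemma measurable_fracpart : measurable_fun setT (fracpart a).
Proof.
apply: measurable_funB => //; apply: measurable_funM => //.
apply: (measurableT_comp measurable_floor).
exact: mulrr_measurable.
Qed.

Lemma periodicz_fracpart g x : periodicz a g -> g (fracpart a x) = g x.
Proof. by move=> pg; rewrite {2}(fracpart_decomp x) pg. Qed.

End Frac.

Lemma tiles_ext (R : realType) (a : R) f g g' :
  tiles a f g -> g =1 g' -> tiles a f g'.
Proof. by move=> h e x; rewrite -e. Qed.

Lemma tilesD (R : realType) (a : R) f g f' g' : tiles a f g -> tiles a f' g' ->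
  tiles a (fun x => f x + f' x) (fun x => g x + g' x).
Proof. by move=> h h' x; apply: fin_sumD. Qed.

Lemma rationally_independentC (R : realType) (a b : R) :
  rationally_independent a b -> rationally_independent b a.
Proof. by move=> h n m; rewrite addrC => /h[]. Qed.

(** * Density of [a Z + b Z] *)

(** Pigeonhole: among the residues modulo [b] of [0, a, ..., N a], two fall into the same of [N]
    boxes of width [b / N < d]. Their difference is nonzero by independence, and its sign can be
    changed. *)
Lemma small_combination (R : realType) (a b d : R) :
  0 < b -> rationally_independent a b -> 0 < d ->
  exists u v : int, 0 < u%:~R * a + v%:~R * b < d.
Proof.
move=> b0 ind d0.
pose N := (Num.bound (b / d)).+1.
have bdN : b / N%:R < d.
  rewrite ltr_pdivrMr ?ltr0n// mulrC -ltr_pdivrMr//.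
  apply: (lt_trans (archi_boundP _)); first by rewrite divr_ge0// ltW.
  by rewrite ltr_nat.
have c0 : 0 < b / N%:R by rewrite divr_gt0// ltr0n.
pose r (i : nat) := fracpart b (i%:Z%:~R * a).
pose box (i : nat) := Num.floor (r i / (b / N%:R)).
have rE i : r i = i%:Z%:~R * a - (Num.floor (i%:Z%:~R * a / b))%:~R * b by [].
have boxP i : (0 <= box i) /\ (box i < N%:Z).
  have /andP[h1 h2] := fracpart_itv b0 (i%:Z%:~R * a).
  rewrite /box floor_ge0 floor_lt_int divr_ge0 ?(ltW c0)//; split => //.
  by rewrite ltr_pdivrMr// mulrCA divff ?mulr1// pnatr_eq0.
have [i [j [ij eij]]] : exists i j : nat, (i < j)%N /\ box i = box j.
  pose f (i : 'I_N.+1) : 'I_N := inord `|box i|%N.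
  have : ~~ injectiveb f.
    apply/negP => /injectiveP/leq_card; rewrite !card_ord; lia.
  move/injectivePn => [i [j nij]] /(congr1 val); rewrite /f /= !inordK; first last.
  - have := boxP i; rewrite /N; lia.
  - have := boxP j; rewrite /N; lia.
  move=> e; have e' : box i = box j by have := boxP i; have := boxP j; lia.
  have [ij|ji] := ltnP i j; first by exists i, j.
  exists j, i; split => //; rewrite ltn_neqAle ji andbT.
  by apply: contra nij => /eqP h; apply/eqP/val_inj.
have close : `|r j - r i| < b / N%:R.
  have /andP[hi1 hi2] := floor_itv (r i / (b / N%:R)).
  have /andP[hj1 hj2] := floor_itv (r j / (b / N%:R)).
  rewrite -/(box i) eij in hi1 hi2; rewrite -/(box j) in hj1 hj2.
  move: hi1 hi2 hj1 hj2; rewrite intrD mulr1z !ler_pdivlMr// !ltr_pdivrMr//.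
  rewrite mulrDl mul1r; move: (_ * (b / _)) => t ? ? ? ?.
  rewrite ltr_norml; apply/andP; split; lra.
pose u : int := j%:Z - i%:Z.
pose v : int := Num.floor (i%:Z%:~R * a / b) - Num.floor (j%:Z%:~R * a / b).
have E : r j - r i = u%:~R * a + v%:~R * b by rewrite !rE /u /v !intrB; ring.
have nz : u%:~R * a + v%:~R * b != 0.
  by apply/eqP => /ind[]; rewrite /u; lia.
move: close; rewrite E => close.
have [pos|neg] := ltP 0 (u%:~R * a + v%:~R * b).
  exists u, v; rewrite pos/=; apply: le_lt_trans bdN.
  by rewrite ltW// (le_lt_trans (ler_norm _)).
exists (- u), (- v); rewrite !intrN !mulNr -opprD oppr_gt0 lt_neqAle nz neg/=.
by rewrite (lt_trans _ bdN)// -ler0_norm.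
Qed.

(* Jump by multiples of a small positive [u a + v b]: from a representative
   modulo [b] in [0, b[, a bounded number of jumps leads just above [b]. *)
Lemma bounded_density (R : realType) (a b d : R) :
  0 < b -> rationally_independent a b -> 0 < d ->
  exists (k : R -> int) (M : nat),
    [/\ measurable_fun setT (fun x => (k x)%:~R : R),
        forall x, `|k x| <= M%:Z
      & forall x, near_lattice b d (x + (k x)%:~R * a)].
Proof.
move=> b0 ind d0; have [u [v /andP[c0 cd]]] := small_combination b0 ind d0.
set c := u%:~R * a + v%:~R * b in c0 cd.
(* The [+ 1] makes the landing point strictly larger than [b], as the open interval requires; the
   overshoot is at most [c < d]. *)
pose m x : int := Num.floor ((b - fracpart b x) / c) + 1.
have mE x : (m x)%:~R * c - c <= b - fracpart b x < (m x)%:~R * c.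
  have /andP[] := floor_itv ((b - fracpart b x) / c).
  by rewrite intrD mulr1z ler_pdivlMr// ltr_pdivrMr// !mulrDl mul1r addrK => -> ->.
exists (fun x => m x * u), (absz (Num.floor (b / c) + 1)%R * absz u)%N; split.
- under eq_fun do rewrite intrM.
  apply: measurable_funM => //; rewrite /m; under eq_fun do rewrite intrD.
  apply: measurable_funD => //; apply: (measurableT_comp (@measurable_floor R)).
  apply: measurable_funM => //; apply: measurable_funB => //.
  exact: measurable_fracpart.
- move=> x; rewrite normrM PoszM !abszE ler_wpM2r//.
  have /andP[h1 h2] := fracpart_itv b0 x.
  rewrite !ger0_norm ?addr_ge0 ?floor_ge0 ?divr_ge0 ?subr_ge0
    ?(ltW b0) ?(ltW h2) ?(ltW c0)//.
  by rewrite lerD2r le_floor// ler_pM2r ?invr_gt0// gerBl.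
- move=> x; exists (Num.floor (x / b) + 1 - m x * v).
  have /andP[h1 h2] := mE x.
  have -> : x + (m x * u)%:~R * a - (Num.floor (x / b) + 1 - m x * v)%:~R * b =
     fracpart b x + (m x)%:~R * c - b.
    by rewrite /fracpart /c intrB intrD !intrM mulr1z; ring.
  by apply/andP; split; lra.
Qed.

(** * Translation invariance and periodization *)

Section Translation.
Variable R : realType.
Notation mu := (@lebesgue_measure R).

(** Lebesgue measure is determined by its values on half-open intervals, whose lengths a shift
    preserves. *)
Lemma lebesgue_measure_shift (c : R) (A : set R) : measurable A ->
  mu ((fun x => x + c) @^-1` A) = mu A.
Proof.
move=> mA.
suff : pushforward mu ((fun x => x + c) : _ -> measurableTypeR R) A = mu A by [].
apply/esym/lebesgue_measure_unique => //=; first exact: measurable_funD.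
move=> _ _ [[x y]] _ <-; rewrite /pushforward.
rewrite (_ : _ @^-1` _ = `]x - c, y - c]%classic).
  rewrite !lebesgue_measure_itv/= !lte_fin ltrD2r.
  by case: ifP => // _; rewrite -!EFinB; congr _%:E; ring.
by apply/seteqP; split => z /=; rewrite !in_itv/= ltrBlDr lerBrDr.
Qed.

End Translation.

(** The periodization [w] of [u] is a sum over one fixed finite set of shifts of the representative
    in [0, b), hence measurable. *)
Lemma tiles_bounded (R : realType) (b C : R) (u : R -> R) :
  0 < b -> measurable_fun setT u -> (forall x, u x != 0 -> `|x| <= C) ->
  exists w : R -> R, [/\ measurable_fun setT w, periodicz b w, tiles b u w
    & forall x, w x != 0 -> exists k : int, u (x - k%:~R * b) != 0].
Proof.
move=> b0 mu uC.
(* If [|j| > N] then [|j| b > C + b], so the shift by [j b] takes [0, b) outside the support of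
   [u]. *)
pose N := Num.bound `|(C + b) / b|.
pose s : seq int := [seq i%:Z - N%:Z | i <- iota 0 N.*2.+1].
have sP (j : int) : j \notin s -> N%:Z < `|j|.
  apply: contraR; rewrite -leNgt => jN; apply/mapP; exists (absz (j + N%:Z)).
    by rewrite mem_iota; lia.
  by lia.
have us : uniq s by rewrite map_inj_uniq ?iota_uniq// => i j; lia.
have off x (j : int) : j \notin s -> u (fracpart b x - j%:~R * b) = 0.
  move/sP => Nj; apply/eqP; apply: contraT => /uC.
  have /andP[r0 rb] := fracpart_itv b0 x.
  rewrite leNgt => /negP; case.
  have : C + b < `|j|%:~R * b.
    rewrite -ltr_pdivrMr// (le_lt_trans (ler_norm _))//.
    rewrite (lt_trans (archi_boundP _))//.
    by rewrite -/N; move: Nj; rewrite -(ltr_int R).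
  rewrite intr_norm -[X in _ * X](gtr0_norm b0) -normrM => Cj.
  rewrite -(ltrD2r b) (lt_le_trans Cj)// -lerBlDr.
  rewrite distrC (le_trans _ (lerB_dist _ _))// lerD2l lerN2 ger0_norm// ltW//.
exists (fun x => \sum_(j <- s) u (fracpart b x - j%:~R * b)); split.
- apply: measurable_sum => j; apply: (measurableT_comp mu).
  by apply: measurable_funB => //; exact: measurable_fracpart.
- by move=> x k; rewrite fracpart_shift.
- move=> x; pose n := Num.floor (x / b).
  pose F (k : int) := u (x - k%:~R * b).
  have FE (j : int) : u (fracpart b x - j%:~R * b) = F (n + j).
    by rewrite /F /fracpart -/n intrD; congr u; ring.
  under eq_bigr do rewrite FE.
  rewrite -[X in fin_sum _ X](big_map (fun j => n + j) xpredT F).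
  apply: fin_sum_seq; first by rewrite map_inj_uniq// => i j; exact: addrI.
  move=> k kn; suff : F (n + (k - n)) = 0 by rewrite addrC subrK.
  rewrite -FE off//; apply: contra kn => kn; apply/mapP; exists (k - n) => //.
  by rewrite addrC subrK.
- move=> x /eqP wx; apply: contrapT => /forallNP h; apply: wx.
  apply: big1 => j _.
  have := h (Num.floor (x / b) + j) => /negP; rewrite negbK => /eqP <-.
  by rewrite /fracpart intrD; congr u; ring.
Qed.

(** * Moving a prescription into a small arc of the other circle *)

Section Step.
Variables (R : realType) (a b : R).
Hypotheses (a0 : 0 < a) (b0 : 0 < b) (ind : rationally_independent a b).
Notation mu := (@lebesgue_measure R).
Local Open Scope ereal_scope.

Lemma measurable_supp (f : R -> R) : measurable_fun setT f ->
  measurable [set x | f x != 0%R].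
Proof.
move=> mf; rewrite (_ : [set _ | _] = f @^-1` (~` [set 0%R])).
  by rewrite -[X in measurable X]setTI; apply: mf => //; apply: measurableC.
by apply/seteqP; split => x /= /eqP.
Qed.

(** Each class modulo [a] puts its whole value of [g] on a single representative, chosen within (0,
    d) + b Z; [w] records what this contributes on R/bZ. The choice is a piecewise translation, so
    the support does not grow in measure. *)
Lemma transfer_to_small_arc (d : R) (g : R -> R) : (0 < d)%R ->
  measurable_fun setT g -> periodicz a g ->
  exists u w : R -> R,
    [/\ measurable_fun setT u /\ measurable_fun setT w,
        periodicz b w, tiles a u g /\ tiles b u w,
        (forall x, u x != 0%R -> g x != 0%R /\ near_lattice b d x) /\
        (forall x, w x != 0%R -> near_lattice b d x)
      & mu [set x | u x != 0%R] <= mu ([set x | g x != 0%R] `&` `[0%R, a[)].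
Proof.
move=> d0 mg pg.
have [k [M [mk kM kd]]] := bounded_density b0 ind d0.
(* [E] is a bounded fundamental domain of [a Z] contained in [(0, d) + b Z]. *)
pose E x := (Num.floor (x / a))%:~R == (k (fracpart a x))%:~R :> R.
pose u x := if E x then g x else 0%R.
have mu_ : measurable_fun setT u.
  apply: measurable_fun_if => //.
    apply: measurable_fun_eqr.
      apply: (measurableT_comp (@measurable_floor R)).
      exact: mulrr_measurable.
    apply: (measurableT_comp mk); exact: measurable_fracpart.
  exact: measurable_funTS.
have uE x : u x != 0%R -> g x != 0%R /\ x = (fracpart a x + (k (fracpart a x))%:~R * a)%R.
  rewrite /u; case: ifP => [/eqP Ex gx|]; last by rewrite eqxx.
  by rewrite -Ex -fracpart_decomp.
have ud x : u x != 0%R -> near_lattice b d x by move=> /uE[_ ->].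
have uC x : u x != 0%R -> (`|x| <= (M%:R + 1) * a)%R.
  move=> /uE[_ ->]; have /andP[r0 ra] := fracpart_itv a0 x.
  apply: (le_trans (ler_normD _ _)); rewrite addrC mulrDl mul1r lerD//; last first.
    by rewrite ger0_norm// ltW.
  rewrite normrM (gtr0_norm a0) ler_wpM2r ?(ltW a0)//.
  by rewrite -intr_norm; have := kM (fracpart a x); rewrite -(ler_int R).
have [w [mw pw tw wu]] := tiles_bounded b0 mu_ uC.
exists u, w; split => //.
- split=> // x; pose k0 := (Num.floor (x / a) - k (fracpart a x))%R.
  have xk (j : int) : u (x - j%:~R * a)%R = if j == k0 then g x else 0%R.
    rewrite /u /E -mulNr -intrN fracpart_shift// floor_shift// eqr_int pg.
    by rewrite /k0; congr (if _ then _ else _); apply/eqP/eqP => [<-|->]; rewrite subKr.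
  have := @fin_sum1 _ _ (fun j : int => u (x - j%:~R * a)%R) k0.
  rewrite xk eqxx; apply => j /negbTE jk; by rewrite xk jk.
- split=> [x ux|x /wu[j /ud]]; first by split; [have [] := uE _ ux|exact: ud].
  by rewrite -mulNr -intrN => /(near_lattice_shift).
pose S := [set x | g x != 0%R] `&` `[0%R, a[.
(* Split [0, a) by the value [n - M] of [k], with [n] natural since [|k| <= M]. The support of [u]
   is covered by the translates [T_ n] of the disjoint pieces [S_ n]. *)
pose S_ (n : nat) := S `&` [set x | (k x)%:~R == (n%:Z - M%:Z)%:~R :> R].
pose T_ (n : nat) := (fun x => x + (M%:Z - n%:Z)%:~R * a)%R @^-1` (S_ n).
have mS : measurable S by apply: measurableI => //; exact: measurable_supp.
have mS_ n : measurable (S_ n).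
  apply: measurableI => //.
  rewrite -[X in measurable X]setTI.
  have mc : measurable_fun setT (cst (n%:Z - M%:Z)%:~R : R -> R) by [].
  exact: (measurable_fun_eqr mk mc measurableT (Y := [set true])).
have mT_ n : measurable (T_ n).
  rewrite -[X in measurable X]setTI.
  have mt : measurable_fun setT (fun x : R => x + (M%:Z - n%:Z)%:~R * a)%R.
    exact: measurable_funD.
  exact: mt.
apply: (@le_trans _ _ (\sum_(n <oo) mu (T_ n))).
  apply: measure_sigma_subadditive => //; first exact: measurable_supp.
  move=> x /= ux; have [gx xE] := uE _ ux.
  have [n nE] : exists n : nat, (k (fracpart a x) = n%:Z - M%:Z)%R.
    exists (absz (k (fracpart a x) + M%:Z)%R); have := kM (fracpart a x); lia.
  exists n => //; rewrite /T_ /S_ /S /=.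
  have -> : (x + (M%:Z - n%:Z)%:~R * a = fracpart a x)%R.
    by rewrite {1}xE nE !intrB; ring.
  by rewrite periodicz_fracpart// in_itv/= fracpart_itv// nE.
under eq_eseriesr do rewrite lebesgue_measure_shift//.
rewrite -measure_semi_bigcup//; first last.
- exact: bigcupT_measurable.
- apply/trivIsetP => i j _ _ ij; apply/seteqP.
  split => // x [[_ /= /eqP hi] [_ /= /eqP hj]].
  move: hi; rewrite hj => /eqP; rewrite eqr_int => /eqP; move: ij => /eqP; lia.
apply: le_measure; [|exact: mem_set|].
  by apply: mem_set; exact: bigcupT_measurable.
by move=> x [n _ []].
Qed.
End Step.

(** * Iterated corrections with a small total excess *)

Section Correction.
Variables (R : realType).
Notation mu := (@lebesgue_measure R).
Local Open Scope ereal_scope.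

Definition period_supp (a : R) (g : R -> R) : set R := [set x | g x != 0%R] `&` `[0%R, a[.

Lemma measurable_period_supp a g : measurable_fun setT g -> measurable (period_supp a g).
Proof. by move=> mg; apply: measurableI => //; exact: measurable_supp. Qed.

Lemma measure_near_lattice (a d : R) (g : R -> R) :
  (0 < a)%R -> (0 <= d)%R -> (d <= a)%R -> measurable_fun setT g ->
  (forall x, g x != 0%R -> near_lattice a d x) ->
  mu (period_supp a g) <= d%:E.
Proof.
move=> a0 d0 da mg gd; apply: (@le_trans _ _ (mu `[0%R, d])).
  apply: le_measure; [by apply: mem_set; exact: measurable_period_supp|exact: mem_set|].
  move=> x [/= /gd /(near_lattice_fracpart a0 da) + xa].
  by rewrite fracpart_id ?in_itv//= => /andP[/ltW -> /ltW ->].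
by rewrite lebesgue_measure_itv/= lte_fin; case: ifP => _; rewrite ?oppr0 ?adde0 ?lee_fin.
Qed.

(** One round of the iteration: [F] meets [h] exactly and [g] up to a remainder [g'] that lives on a
    small arc of R/aZ. *)
Record correction (a b d : R) (g h F g' : R -> R) : Prop := Correction {
  correction_measurable : measurable_fun setT F;
  correction_rest_measurable : measurable_fun setT g';
  correction_rest_periodic : periodicz a g';
  correction_tiles_l : tiles a F (fun x => g x - g' x)%R;
  correction_tiles_r : tiles b F h;
  correction_near_l : forall x, F x != 0%R -> g x != 0%R \/ near_lattice a d x;
  correction_near_r : forall x, F x != 0%R -> h x != 0%R \/ near_lattice b d x;
  correction_rest_near : forall x, g' x != 0%R -> near_lattice a d x;
  correction_le : mu [set x | F x != 0%R] <= mu (period_supp a g) + mu (period_supp b h) + d%:E }.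

(** First [u] meets [g] and spoils R/bZ by [w]; then [v] meets [h - w] and spoils R/aZ by [w'].
    Hence [F = u + v] and [g' = - w']. The extra [d] in the measure pays for the arc carrying
    [w]. *)
Lemma correction_step (a b d : R) (g h : R -> R) :
  (0 < a)%R -> (0 < b)%R -> rationally_independent a b ->
  (0 < d)%R -> (d <= b)%R ->
  measurable_fun setT g -> measurable_fun setT h ->
  periodicz a g -> periodicz b h ->
  exists F g' : R -> R, correction a b d g h F g'.
Proof.
move=> a0 b0 ind d0 db mg mh pg ph.
have [u [w [[mu_ mw] pw [tu tuw] [ug wd] uS]]] := transfer_to_small_arc a0 b0 ind d0 mg pg.
have mh' : measurable_fun setT (fun x => h x - w x)%R by exact: measurable_funB.
have ph' : periodicz b (fun x => h x - w x)%R by move=> x k; rewrite ph pw.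
have [v [w' [[mv mw'] pw' [tv tvw] [vh w'd] vS]]] :=
  transfer_to_small_arc b0 a0 (rationally_independentC ind) d0 mh' ph'.
have hw x : (h x - w x != 0 -> h x != 0 \/ w x != 0)%R.
  by have [->|] := eqVneq (h x) 0%R; [rewrite sub0r oppr_eq0; right|left].
have uv x : (u x + v x != 0 -> u x != 0 \/ v x != 0)%R.
  by have [->|] := eqVneq (u x) 0%R; [rewrite add0r; right|left].
exists (fun x => u x + v x)%R, (fun x => - w' x)%R; split.
- exact: measurable_funD.
- exact: measurableT_comp.
- by move=> x k; rewrite pw'.
- by apply: tiles_ext (tilesD tu tvw) _ => x; rewrite opprK.
- by apply: tiles_ext (tilesD tuw tv) _ => x; rewrite addrC subrK.
- by move=> x /uv[/ug[]|/vh[]]; [left|right].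
- by move=> x /uv[/ug[]|/vh[/hw[|/wd]]]; [right|left|right].
- by move=> x; rewrite oppr_eq0 => /w'd.
apply: (@le_trans _ _ (mu ([set x | u x != 0%R] `|` [set x | v x != 0%R]))).
  apply: le_measure; [apply: mem_set|apply: mem_set|by move=> x /= /uv].
    by apply: measurable_supp; exact: measurable_funD.
  by apply: measurableU; exact: measurable_supp.
apply: (le_trans (measureU2 _ _ _)); [exact: measurable_supp|exact: measurable_supp|].
rewrite -addeA leeD// (le_trans vS)//.
apply: (@le_trans _ _ (mu (period_supp b h `|` period_supp b w))).
  apply: le_measure; [by apply: mem_set; exact: measurable_period_supp| |].
    by apply: mem_set; apply: measurableU; exact: measurable_period_supp.
  by move=> x [/= /hw[] ? ?]; [left|right].
apply: (le_trans (measureU2 _ _ _)); [exact: measurable_period_supp|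
  exact: measurable_period_supp|].
by rewrite leeD// measure_near_lattice// ltW.
Qed.

(** Each remainder is the prescription of the next round, on arcs shrinking geometrically. Every
    class meets finitely many rounds only, so the sum of all rounds is finite at each point and
    meets both prescriptions. *)
Lemma tiling_with_small_excess (a b e : R) (g h : R -> R) :
  (0 < a)%R -> (0 < b)%R -> rationally_independent a b -> (0 < e)%R ->
  measurable_fun setT g -> measurable_fun setT h ->
  periodicz a g -> periodicz b h ->
  exists f : R -> R,
    [/\ measurable_fun setT f, tiles a f g, tiles b f h
      & mu [set x | f x != 0%R] <= mu (period_supp a g) + mu (period_supp b h) + e%:E].
Proof.
move=> a0 b0 ind e0 mg mh pg ph.
pose d (n : nat) : R := (Num.min (e / 4 / (2 ^ n.+1)%:R) (Num.min a b))%R.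
have dpos n : (0 < d n)%R by rewrite !lt_min a0 b0 !divr_gt0// ltr0n expn_gt0.
have da n : (d n <= a)%R by rewrite !ge_min lexx orbT.
have db n : (d n <= b)%R by rewrite !ge_min lexx !orbT.
have de n : (d n <= e / 4 / (2 ^ n.+1)%:R)%R by rewrite ge_min lexx.
have dS n : (d n.+1 <= d n)%R.
  rewrite /d; move: (Num.min a b) => m; rewrite le_min !ge_min lexx orbT andbT.
  rewrite ler_pM2l ?divr_gt0// lef_pV2 ?posrE ?ltr0n ?expn_gt0//.
  by rewrite ler_nat leq_exp2l ?leqnSn.
have dvanish r : (0 < r)%R -> exists N, forall n, (N <= n)%N -> (d n <= r)%R.
  move=> r0; exists (Num.bound (e / r)%R) => n nN; apply: (le_trans (de n)).
  rewrite ler_pdivrMr ?ltr0n ?expn_gt0// (@le_trans _ _ e)//; first by lra.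
  rewrite mulrC -ler_pdivrMr// ltW// (lt_le_trans (archi_boundP _))//.
    by rewrite divr_ge0// ltW.
  rewrite ler_nat (leq_trans nN)// (leq_trans (leqnSn n))//.
  by rewrite ltnW// ltn_expl.
(* Round 0 meets [h] exactly, so later rounds must sum to zero over the classes modulo [b]. *)
pose hs n := if n is 0%N then h else (fun=> 0%R).
have mhs n : measurable_fun setT (hs n) by case: n => // n; exact: measurable_cst.
have phs n : periodicz b (hs n) by case: n => // n x k.
pose good (g : R -> R) := measurable_fun setT g /\ periodicz a g.
have step (ng : nat * (R -> R)) : exists Fg : (R -> R) * (R -> R), good ng.2 ->
    correction a b (d ng.1) ng.2 (hs ng.1) Fg.1 Fg.2.
  (* The pair [(ng.2, ng.2)] is a dummy value, making the choice function total. *)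
  have [[mg' pg']|?] := pselect (good ng.2); last by exists (ng.2, ng.2).
  have [F [g' C]] :=
    correction_step a0 b0 ind (dpos ng.1) (db ng.1) mg' (mhs ng.1) pg' (phs ng.1).
  by exists (F, g').
have [S SP] := choice step.
pose gs := fix gs n := if n is m.+1 then (S (m, gs m)).2 else g.
pose F n := (S (n, gs n)).1.
have gsP n : good (gs n).
  by elim: n => [//|n /(SP (n, gs n)) []].
have C n : correction a b (d n) (gs n) (hs n) (F n) (gs n.+1) := SP (n, gs n) (gsP n).
have gsnear n x : gs n.+1 x != 0%R -> near_lattice a (d n) x.
  exact: correction_rest_near (C n) x.
have Fa n x : F n.+1 x != 0%R -> near_lattice a (d n) x.
  move=> /(correction_near_l (C n.+1))[/gsnear//|].
  exact: near_lattice_le.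
have Fb n x : F n.+1 x != 0%R -> near_lattice b (d n) x.
  move=> /(correction_near_r (C n.+1))[|]; first by rewrite eqxx.
  exact: near_lattice_le.
(* A class either contains 0, which the open arcs avoid, or has a positive representative, which the
   arcs eventually do not reach. *)
have far c x : (0 < c)%R -> (forall n, (d n <= c)%R) ->
    exists N, forall n, (N <= n)%N -> ~ near_lattice c (d n) x.
  move=> c0 dc; have /andP[] := fracpart_itv c0 x.
  rewrite le_eqVlt => /orP[/eqP r0 _|r0 _].
    exists 0%N => n _ /(near_lattice_fracpart c0 (dc n)).
    by rewrite -r0 ltxx.
  have [N hN] := dvanish _ r0; exists N => n /hN dn /(near_lattice_fracpart c0 (dc n)).
  by case/andP => _; rewrite ltNge dn.
have Fzero c x : (0 < c)%R -> (forall n, (d n <= c)%R) ->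
    (forall n x, F n.+1 x != 0%R -> near_lattice c (d n) x) ->
    exists N, forall n (k : int), (N <= n)%N -> F n (x - k%:~R * c)%R = 0%R.
  move=> c0 dc Fc; have [N hN] := far c x c0 dc; exists N.+1 => -[//|n] k /hN Nn.
  apply/eqP; apply: contrapT => /negP/Fc; rewrite -mulNr -intrN.
  by move/near_lattice_shift.
pose f x := limn (fun n => \sum_(0 <= i < n) F i x)%R.
have fE x N : (forall n, (N <= n)%N -> F n x = 0%R) ->
    (fun n => \sum_(0 <= i < n) F i x)%R @ \oo --> (\sum_(0 <= i < N) F i x)%R.
  move=> FN; apply: cvg_near_cst; exists N => // n /= Nn.
  rewrite (big_cat_nat _ Nn)//=.
  rewrite [X in (_ + X)%R]big_nat_cond [X in (_ + X)%R]big1 ?addr0//.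
  by move=> i /andP[/andP[/FN]].
have Fz x : exists N, forall n, (N <= n)%N -> F n x = 0%R.
  have [N hN] := Fzero a x a0 da Fa; exists N => n Nn.
  by have := hN n 0%R Nn; rewrite mul0r subr0.
have fE' x N : (forall n, (N <= n)%N -> F n x = 0%R) -> f x = (\sum_(0 <= i < N) F i x)%R.
  by move=> /fE /cvg_lim; apply.
have mf : measurable_fun setT f.
  apply: (measurable_fun_cvg (h := fun n x => \sum_(0 <= i < n) F i x)%R).
    by move=> n; apply: measurable_sum => i; exact: correction_measurable (C i).
  by move=> x _; have [N hN] := Fz x; rewrite (fE' x N hN); exact: fE.
(* The bound [N] from [Fzero] serves all translates [x - k c] at once, so on a class [f] is one
   finite sum of rounds and the tilings add up. *)
have ftiles c (t : nat -> R -> R) (s : R -> R) : (0 < c)%R -> (forall n, (d n <= c)%R) ->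
    (forall n x, F n.+1 x != 0%R -> near_lattice c (d n) x) ->
    (forall n, tiles c (F n) (t n)) ->
    (forall x, exists N0, forall n, (N0 <= n)%N ->
      (\sum_(0 <= i < n) t i x)%R = s x) -> tiles c f s.
  move=> c0 dc Fc Ft ts x.
  have [N hN] := Fzero c x c0 dc Fc; have [N0 hN0] := ts x.
  have -> : (fun k : int => f (x - k%:~R * c)%R) =
      (fun k : int => \sum_(0 <= i < maxn N N0) F i (x - k%:~R * c))%R.
    apply/funext => k; apply: fE' => n; rewrite geq_max => /andP[Nn _]; exact: hN.
  rewrite -(hN0 (maxn N N0)) ?leq_maxr//; apply: fin_sum_sum => i; exact: Ft.
exists f; split => //.
- apply: (ftiles a (fun n x => gs n x - gs n.+1 x)%R) => //.
    by move=> n; exact: correction_tiles_l (C n).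
  move=> x; have [N hN] := far a x a0 da; exists N.+1 => -[//|n] /hN Nn.
  rewrite (telescope_sumr_eq (fun n => - gs n x)%R)//; last first.
    by move=> i _; rewrite opprK addrC.
  rewrite opprK (_ : gs n.+1 x = 0%R) ?oppr0 ?add0r//.
  by apply/eqP; apply: contrapT => /negP/gsnear.
- apply: (ftiles b hs) => //; first by move=> n; exact: correction_tiles_r (C n).
  move=> x; exists 1%N => -[//|n] _; rewrite big_nat_recl//= big1 ?addr0//.
(* Only round 0 pays for the supports of [g] and [h]. Round [n + 1] costs at most [d n + d (n + 1)],
   below [e / 2 ^ (n + 2)]; these bounds sum to [e]. *)
pose A n : \bar R := if n is 0%N then mu (period_supp a g) + mu (period_supp b h) else 0.
have A0 n : 0 <= A n by case: n => //=; rewrite adde_ge0.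
have FA n : mu [set x | F n x != 0%R] <= A n + (e / (2 ^ n.+1)%:R)%:E.
  apply: (le_trans (correction_le (C n))).
  case: n => [|n] /=.
    by rewrite leeD2l// lee_fin (le_trans (de 0%N))// ler_wpM2r ?invr_ge0//; lra.
  have -> : period_supp b (fun=> 0%R) = set0.
    by apply/seteqP; split => // x [/=]; rewrite eqxx.
  rewrite measure0 adde0 add0e.
  apply: (@le_trans _ _ ((d n)%:E + (d n.+1)%:E)).
    rewrite leeD2r// measure_near_lattice ?(ltW (dpos n))//; first exact: (gsP n.+1).1.
    exact: gsnear.
  rewrite -EFinD lee_fin; have := de n; have := de n.+1.
  have -> : ((2 ^ n.+2)%:R^-1 = (2 ^ n.+1)%:R^-1 / 2 :> R)%R.
    by rewrite [in LHS]expnS natrM invfM mulrC.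
  have : (0 < e * (2 ^ n.+1)%:R^-1)%R by rewrite divr_gt0// ltr0n expn_gt0.
  by move: (_^-1)%R => t ? ? ?; lra.
apply: (@le_trans _ _ (\sum_(n <oo) mu [set x | F n x != 0%R])).
  apply: measure_sigma_subadditive.
  - by move=> n; apply: measurable_supp; exact: correction_measurable (C n).
  - exact: measurable_supp.
  move=> x /= /eqP fx; apply: contrapT => nx; apply: fx.
  rewrite (fE' x 0%N) ?big_nil// => n _; apply/eqP; apply: contrapT => /negP Fx.
  by apply: nx; exists n.
apply: (@le_trans _ _ (\sum_(n <oo) (A n + (e / (2 ^ n.+1)%:R)%:E))).
  exact: lee_nneseries.
apply: (le_trans (epsilon_trick _ _ _)) => //; first exact: ltW.
rewrite leeD2r// nneseries_recl// eseries0 ?adde0//.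
by case.
Qed.
End Correction.

(** * Families of disjoint arcs on a circle *)

Lemma eq_of_congruent (i j q : nat) (m : int) : (i < q)%N -> (j < q)%N ->
  i%:Z - m * q%:Z = j%:Z -> j = i.
Proof.
move=> iq jq e; have : (i%:Z = j%:Z %[mod q%:Z])%Z.
  by rewrite -e -mulNr addrC modzMDl.
by rewrite !modz_nat !modn_small// => -[].
Qed.

Section Blocks.
Variable R : realType.
Notation mu := (@lebesgue_measure R).

Lemma measure_cover_le (n : nat) (S : set R) (G : nat -> set R) (c : R) :
  measurable S -> (forall k, measurable (G k)) ->
  (forall k, (k < n)%N -> (mu (G k) <= c%:E)%E) ->
  (forall x, S x -> exists2 k, (k < n)%N & G k x) ->
  (mu S <= (n%:R * c)%:E)%E.
Proof.
move=> mS mG Gc SG.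
have SU : S `<=` \big[setU/set0]_(k < n) G k.
  by move=> x /SG[k kn Gk]; rewrite -bigcup_mkord; exists k.
apply: (le_trans (@content_subadditive _ _ _ mu S G n (fun k _ => mG k) mS SU)).
apply: (@le_trans _ _ (\sum_(k < n) c%:E)%E); first by apply: lee_sum => k _; exact: Gc.
by rewrite sumEFin lee_fin sumr_const card_ord mulr_natl.
Qed.

(** For [0 < l <= a], the indicator of the arc [y, y + l) + a Z. *)
Definition arc_indic (a l y x : R) : R := (fracpart a (x - y) < l)%R%:R.

Lemma tiles_interval (a l y : R) (m : int) : 0 < a -> l <= a ->
  tiles a (fun x => (y + m%:~R * a <= x < y + m%:~R * a + l)%R%:R) (arc_indic a l y).
Proof.
move=> a0 la x; pose k0 := Num.floor ((x - y) / a) - m.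
set F := (fun k : int => _).
have FE k : F k = (0 <= x - y - (k + m)%:~R * a < l)%R%:R.
  rewrite /F intrD; congr (nat_of_bool _)%:R; congr andb.
    by apply/idP/idP => ?; lra.
  by apply/idP/idP => ?; lra.
have -> : arc_indic a l y x = F k0.
  rewrite FE /k0 subrK -/(fracpart a (x - y)) /arc_indic.
  by case/andP: (fracpart_itv a0 (x - y)) => h _; rewrite h.
apply: fin_sum1 => k kk0; rewrite FE; case: (boolP (_ && _)) => // /andP[h1 h2].
have xyE : x - y = x - y - (k + m)%:~R * a + (k + m)%:~R * a by rewrite subrK.
move: kk0; rewrite /k0 {1}xyE.
by rewrite floor_add// ?addrK ?eqxx// h1 (lt_le_trans h2).
Qed.

Lemma measurable_arc_indic (a l y : R) : measurable_fun setT (arc_indic a l y).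
Proof.
have mf : measurable_fun setT (fun x : R => fracpart a (x - y)).
  apply: (measurableT_comp (@measurable_fracpart R a)).
  exact: measurable_funB.
have mb : measurable_fun setT (fun x : R => fracpart a (x - y) < l).
  exact: measurable_fun_ltr.
have -> : arc_indic a l y = fun x => if fracpart a (x - y) < l then 1 else 0.
  by apply/funext => x; rewrite /arc_indic; case: ifP.
exact: measurable_fun_if.
Qed.

Lemma periodicz_arc_indic (a l y : R) : 0 < a -> periodicz a (arc_indic a l y).
Proof. by move=> a0 x k; rewrite /arc_indic addrAC fracpart_shift. Qed.

(** Each of the [q] cells of length [L = a / q] contains one arc, and the two gaps around it have
    total length [L - l]. *)
Lemma measure_arcs_complement (a l : R) (q : nat) (c : R) (y : nat -> R) :
  (0 < q)%N -> 0 < a -> 0 < l ->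
  (forall i, (i < q)%N -> i%:R * (a / q%:R) <= y i /\ y i + l <= i.+1%:R * (a / q%:R)) ->
  (mu (period_supp a (fun x => c * (1 - \sum_(i < q) arc_indic a l (y i) x))%R) <=
     (a - q%:R * l)%:E)%E.
Proof.
move=> q0 a0 l0 yL.
have qn0 : q%:R != 0 :> R by rewrite pnatr_eq0 -lt0n.
set L := a / q%:R in yL *.
have L0 : 0 < L by rewrite divr_gt0// ltr0n.
have aL : a = q%:R * L by rewrite /L mulrCA divff// mulr1.
pose G i := `[i%:R * L, y i] `|` `[y i + l, i.+1%:R * L].
have -> : a - q%:R * l = q%:R * (L - l) by rewrite mulrBr -aL.
apply: (@measure_cover_le _ _ G).
- apply: measurable_period_supp; apply: measurable_funM => //; apply: measurable_funB => //.
  by apply: measurable_sum => i; exact: measurable_arc_indic.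
- by move=> i; apply: measurableU.
- move=> i /yL[y1 y2]; apply: (le_trans (measureU2 _ _ _)) => //.
  rewrite /= !lebesgue_measure_itv/= !lte_fin.
  have -> : (L - l)%:E = ((y i - i%:R * L)%:E + (i.+1%:R * L - (y i + l))%:E)%E.
    by rewrite -EFinD -natr1; congr _%:E; ring.
  by apply: leeD; case: ifP => _; rewrite -?EFinB ?lee_fin ?subr_ge0.
move=> x [/= /eqP gx]; rewrite in_itv/= => /andP[x0 xa].
pose i := absz (Num.floor (x / L)).
have iE : Num.floor (x / L) = i%:Z by rewrite gez0_abs// floor_ge0 divr_ge0// ltW.
have /andP[ix xi] := floor_itv (x / L); rewrite iE in ix xi.
have iq : (i < q)%N.
  by rewrite -ltz_nat -iE floor_lt_int ltr_pdivrMr// -aL.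
rewrite ler_pdivlMr// in ix; rewrite ltr_pdivrMr// in xi.
exists i => //; rewrite /G /=; apply: contrapT => /not_orP[].
rewrite !in_itv/= ix/= => /negP; rewrite -ltNge => yx /negP.
have -> : i.+1%:R = (i%:Z + 1)%:~R :> R by rewrite -natr1 intrD.
rewrite (ltW xi) andbT -ltNge => xy; apply: gx.
have [y1 y2] := yL i iq.
have la : l <= a.
  rewrite aL (le_trans (_ : l <= L))//; last by rewrite ler_peMl ?(ltW L0)// ler1n.
  by move: y1 y2; rewrite -natr1; lra.
rewrite (bigD1 (Ordinal iq))//= big1 ?addr0.
  rewrite /arc_indic fracpart_id ?ltrBlDl ?xy ?subrr ?mulr0// subr_ge0 (ltW yx)/=.
  by rewrite (lt_le_trans xy)// lerD2l.
(* No other arc [j] contains the class of [x]: modulo [a = q L], the point would lie in cell [j] as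
   well as in cell [i], and both indices are below [q]. *)
move=> j ji; rewrite /arc_indic; case: (boolP (_ < _)) => // hj; exfalso.
move/eqP: ji; apply; apply/val_inj => /=.
have [y1j y2j] := yL j (ltn_ord j).
have /andP[fj0 _] := fracpart_itv a0 (x - y j).
have : Num.floor ((x + (- (Num.floor ((x - y j) / a) * q%:Z))%:~R * L) / L) = j.
  apply: floor_def; rewrite ler_pdivlMr// ltr_pdivrMr// intrD mulr1z -!pmulrn.
  have -> : x + (- (Num.floor ((x - y j) / a) * q%:Z))%:~R * L =
      y j + fracpart a (x - y j).
    by rewrite /fracpart intrN intrM aL; ring.
  by apply/andP; split; move: y1j y2j; rewrite -natr1; lra.
rewrite floor_shift// iE; exact: eq_of_congruent.
Qed.

End Blocks.

(** * The staircase tree and the real-valued tiling *)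

Section Initial.
Variable R : realType.
Notation mu := (@lebesgue_measure R).

(** Density puts a point of [a Z + b Z] in the initial part of length [a / q - l] of each cell,
    leaving room for an interval of length [l]. *)
Lemma block_positions (a b l : R) (q : nat) : 0 < a -> 0 < b ->
  rationally_independent a b -> (0 < q)%N -> l < a / q%:R ->
  exists ka kb : nat -> int, forall i,
    i%:R * (a / q%:R) <= (ka i)%:~R * a + (kb i)%:~R * b /\
    (ka i)%:~R * a + (kb i)%:~R * b + l <= i.+1%:R * (a / q%:R).
Proof.
move=> a0 b0 ind q0 lL; have L0 : 0 < a / q%:R - l by rewrite subr_gt0.
have [k [M [_ _ kd]]] := bounded_density b0 ind L0.
have [m hm] := choice (fun i : nat => kd (- (i%:R * (a / q%:R)))).
exists (fun i => k (- (i%:R * (a / q%:R)))), (fun i => - m i) => i.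
have /andP[h1 h2] := hm i.
by rewrite intrN mulNr -natr1; split; lra.
Qed.

Lemma sum_divn (p q : nat) (F : nat -> R) : (0 < p)%N ->
  \sum_(t < q * p) F (t %/ p)%N = p%:R * \sum_(i < q) F i.
Proof.
move=> p0; elim: q => [|q IH]; first by rewrite mul0n !big_ord0 mulr0.
rewrite mulSnr big_split_ord/= IH big_ord_recr/= mulrDr; congr (_ + _).
rewrite (eq_bigr (fun=> F q)) ?sumr_const ?card_ord ?mulr_natl// => i _.
by rewrite divnMDl// divn_small ?addn0.
Qed.

(* The [p * q] units of mass laid out on a line, cut every [p] and every [q]
   units, visit the cells of a [q * p] matrix along a staircase. *)
Lemma staircase (p q t t' : nat) : (t %/ p + t %/ q = t' %/ p + t' %/ q)%N ->
  (t %/ p = t' %/ p)%N /\ (t %/ q = t' %/ q)%N.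
Proof.
wlog tt' : t t' / (t <= t')%N => [wl|].
  by case: (leqP t t') => [/wl//|/ltnW/wl h /esym/h[]].
have := leq_div2r p tt'; have := leq_div2r q tt'; lia.
Qed.

(** Each unit [t] of mass becomes an interval of length [l] joining arc [t %/ p] of R/aZ to arc
    [t %/ q] of R/bZ. Arcs then receive [p] units on one side and [q] on the other; [g] and [h] are
    the prescriptions left off the arcs. *)
Lemma initial_tiling (a b l : R) (p q : nat) : 0 < a -> 0 < b ->
  rationally_independent a b -> (0 < p)%N -> (0 < q)%N ->
  0 < l -> l < a / q%:R -> l < b / p%:R ->
  exists f g h : R -> R,
  [/\ [/\ measurable_fun setT f, measurable_fun setT g & measurable_fun setT h],
      periodicz a g /\ periodicz b h,
      tiles a f (fun x => p%:R - g x) /\ tiles b f (fun x => q%:R - h x),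
      (mu [set x | f x != 0%R] <= ((p + q).-1%:R * l)%:E)%E
    & (mu (period_supp a g) <= (a - q%:R * l)%:E)%E /\
      (mu (period_supp b h) <= (b - p%:R * l)%:E)%E].
Proof.
move=> a0 b0 ind p0 q0 l0 la lb.
have [ka [kb hk]] := block_positions a0 b0 ind q0 la.
have [lb' [la' hl]] := block_positions b0 a0 (rationally_independentC ind) p0 lb.
pose x_ i := (ka i)%:~R * a + (kb i)%:~R * b.
pose y_ j := (lb' j)%:~R * b + (la' j)%:~R * a.
(* Congruent to [x_ i] modulo [a] and to [y_ j] modulo [b]: this is the edge between arc [i] and arc
   [j]. *)
pose z_ i j := (la' j)%:~R * a + (kb i)%:~R * b.
pose I_ z : R -> R := fun x => (z <= x < z + l)%R%:R.
pose f x := \sum_(t < q * p) I_ (z_ (t %/ p)%N (t %/ q)%N) x.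
pose g x := p%:R * (1 - \sum_(i < q) arc_indic a l (x_ i) x).
pose h x := q%:R * (1 - \sum_(j < p) arc_indic b l (y_ j) x).
have leq1 (n : nat) (c : R) : 0 < c -> (0 < n)%N -> c / n%:R <= c.
  by move=> c0 n0; rewrite ler_pdivrMr ?ltr0n// ler_peMr ?(ltW c0)// ler1n.
have la_ : l <= a by rewrite (le_trans (ltW la))// leq1.
have lb_ : l <= b by rewrite (le_trans (ltW lb))// leq1.
have zx i j : z_ i j = x_ i + (la' j - ka i)%:~R * a.
  by rewrite /z_ /x_ intrB; ring.
have zy i j : z_ i j = y_ j + (kb i - lb' j)%:~R * b.
  by rewrite /z_ /y_ intrB; ring.
have mI z : measurable_fun setT (I_ z).
  have -> : I_ z = \1_(`[z, z + l[).
    apply/funext => x; rewrite indicE /I_; congr (nat_of_bool _)%:R.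
    by apply/idP/idP => [hx|/set_mem]; [apply: mem_set|]; rewrite /= in_itv.
  exact: measurable_indic.
have marcs (n : nat) (c d : R) (w : nat -> R) :
    measurable_fun setT (fun x => d * (1 - \sum_(i < n) arc_indic c l (w i) x)).
  apply: measurable_funM => //; apply: measurable_funB => //.
  by apply: measurable_sum => i; exact: measurable_arc_indic.
have parcs (n : nat) (c d : R) (w : nat -> R) : 0 < c ->
    periodicz c (fun x => d * (1 - \sum_(i < n) arc_indic c l (w i) x)).
  move=> c0 x k; congr (_ * (_ - _)); apply: eq_bigr => i _; exact: periodicz_arc_indic.
exists f, g, h; split.
- by split; [exact: measurable_sum|exact: marcs|exact: marcs].
- by split; exact: parcs.
- split.
    apply: tiles_ext
        (_ : tiles a f (fun x => \sum_(t < q * p) arc_indic a l (x_ (t %/ p)%N) x)) _.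
      by move=> x; apply: fin_sum_sum => t; rewrite zx; exact: tiles_interval.
    move=> x.
    by rewrite (sum_divn _ (fun i => arc_indic a l (x_ i) x))// /g mulrBr mulr1 subKr.
  apply: tiles_ext
      (_ : tiles b f (fun x => \sum_(t < q * p) arc_indic b l (y_ (t %/ q)%N) x)) _.
    by move=> x; apply: fin_sum_sum => t; rewrite zy; exact: tiles_interval.
  move=> x.
  by rewrite mulnC (sum_divn _ (fun i => arc_indic b l (y_ i) x))// /h mulrBr mulr1 subKr.
(* The sum [s] of the two indices determines the edge visited, and [s <= (q - 1) + (p - 1)], so at
   most [p + q - 1] intervals carry [f]. *)
- have Zex s : exists z, forall t, (t %/ p + t %/ q)%N = s ->
      z_ (t %/ p)%N (t %/ q)%N = z.
    have [[t ts]|ns] := pselect (exists t, (t %/ p + t %/ q)%N = s).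
      exists (z_ (t %/ p)%N (t %/ q)%N) => t'; rewrite -ts.
      by move=> /staircase[-> ->].
    by exists 0 => t ts; exfalso; apply: ns; exists t.
  have [Z ZP] := choice Zex.
  apply: (@measure_cover_le _ _ _ (fun s => `[Z s, Z s + l[%classic)).
  + by apply: measurable_supp; apply: measurable_sum.
  + by [].
  + move=> s _; rewrite lebesgue_measure_itv/= lte_fin ltrDl l0.
    by rewrite -EFinB lee_fin addrAC subrr add0r.
  move=> x /= /eqP fx; apply: contrapT => nx; apply: fx.
  apply: big1 => t _; rewrite (ZP _ _ erefl) /I_.
  case: (boolP (_ && _)) => // hx; exfalso; apply: nx.
  exists (t %/ p + t %/ q)%N; last by rewrite /= in_itv.
  have : (t %/ p < q)%N by rewrite ltn_divLR.
  have : (t %/ q < p)%N by rewrite ltn_divLR// [(p * q)%N]mulnC.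
  lia.
- by split; apply: measure_arcs_complement.
Qed.

(** The costs add up to [(p + q - 1) l + (a - q l) + (b - p l) + e / 3 = a + b - l + e / 3], with
    [l] close to the minimum. *)
Lemma step_tiling (a b e : R) (p q : nat) :
  0 < a -> 0 < b -> rationally_independent a b ->
  (0 < p)%N -> (0 < q)%N -> 0 < e ->
  exists f : R -> R, [/\ measurable_fun setT f,
    tiles a f (fun=> p%:R), tiles b f (fun=> q%:R)
  & (mu [set x | f x != 0%R] < (a + b - Num.min (a / q%:R) (b / p%:R) + e)%:E)%E].
Proof.
move=> a0 b0 ind p0 q0 e0.
set m := Num.min _ _.
have m0 : 0 < m by rewrite lt_min !divr_gt0 ?ltr0n.
(* The bound [m / 2] keeps [l] positive; the bound [e / 3] keeps the total excess at most
   [2 e / 3]. *)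
pose r := Num.min (e / 3) (m / 2).
have r0 : 0 < r by rewrite lt_min !divr_gt0.
have re : r <= e / 3 by rewrite ge_min lexx.
have rm : r <= m / 2 by rewrite ge_min lexx orbT.
pose l := m - r.
have l0 : 0 < l by rewrite /l; lra.
have lm : l < m by rewrite /l; lra.
have la : l < a / q%:R by rewrite (lt_le_trans lm)// ge_min lexx.
have lb : l < b / p%:R by rewrite (lt_le_trans lm)// ge_min lexx orbT.
have [f [g [h [[mf mg mh] [pg ph] [ta tb] fS [gS hS]]]]] :=
  initial_tiling a0 b0 ind p0 q0 l0 la lb.
have e3 : 0 < e / 3 by rewrite divr_gt0.
have [f' [mf' ta' tb' f'S]] := tiling_with_small_excess a0 b0 ind e3 mg mh pg ph.
exists (fun x => f x + f' x); split.
- exact: measurable_funD.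
- by apply: tiles_ext (tilesD ta ta') _ => x; rewrite subrK.
- by apply: tiles_ext (tilesD tb tb') _ => x; rewrite subrK.
apply: (@le_lt_trans _ _ (mu ([set x | f x != 0] `|` [set x | f' x != 0]))).
  apply: le_measure; [apply: mem_set|apply: mem_set|].
  + by apply: measurable_supp; exact: measurable_funD.
  + by apply: measurableU; exact: measurable_supp.
  by move=> x /=; have [->|] := eqVneq (f x) 0; [rewrite add0r; right|left].
apply: (le_lt_trans (measureU2 _ _ _)); [exact: measurable_supp|exact: measurable_supp|].
apply: (le_lt_trans (leeD fS (le_trans f'S (leeD (leeD gS hS) (lexx _))))).
rewrite -!EFinD lte_fin.
have -> : (p + q).-1%:R = p%:R + q%:R - 1 :> R.
  by rewrite -natrD -[in RHS](@prednK (p + q)) ?addn_gt0 ?p0// -natr1 addrK.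
by move: re; rewrite /l; lra.
Qed.

End Initial.

(** * Passage to complex values and to the completed measure *)

Section Transfer.
Variable R : realType.

Lemma open_preimage_real_complex (U : set R[i]^o) : open U ->
  open ((fun x : R => x%:C : R[i]^o) @^-1` U).
Proof.
rewrite !openE => oU x /= /oU /nbhs_ballP[e /= e0 eU].
have := e0; rewrite ltcE/= => /andP[/eqP e_real e_pos].
apply/nbhs_ballP; exists (complex.Re e) => //= y xy.
apply: eU; rewrite /ball/= -rmorphB/= normc_def/= expr0n/= addr0 sqrtr_sqr.
by rewrite ltcE/= e_real eqxx.
Qed.

Lemma measurable_real_complex :
  measurable_fun setT ((fun x => x%:C) : measurableTypeR R -> borelC R).
Proof.
apply: (@measurability _ _ (measurableTypeR R) (borelC R) setT
     (fun x => x%:C) (@open R[i]^o)).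
  by [].
move=> _ [U oU <-].
by rewrite setTI; apply: open_measurable; apply: open_preimage_real_complex.
Qed.

Lemma lebesgue_measurable_real_complex (f : R -> R) : measurable_fun setT f ->
  lebesgue_measurable_fun (fun x => (f x)%:C).
Proof.
(* Borel sets are Caratheodory measurable, so a Borel preimage suffices. *)
move=> mf _ Y mY; rewrite setTI; apply: sub_caratheodory.
rewrite -[X in measurable X]setTI.
by apply: (measurableT_comp measurable_real_complex mf).
Qed.

Lemma abs_cvg_fin_sum (F : int -> R) (s : R) : fin_sum F s ->
  abs_cvg (fun k => (F k)%:C).
Proof.
move=> /fin_sum_finite_support[A FA]; rewrite /abs_cvg /summable.
rewrite (esumID [set` A])// [X in (_ + X)%E]esum1 ?adde0; last first.
  move=> k [_ /= /negP kA]; rewrite FA//.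
  by rewrite /ComplexField.Normc.normc/= expr0n/= addr0 sqrtr0 normr0.
rewrite setTI esum_fset// fsbig_finite//=.
by apply: lte_sum_pinfty => k _; exact: ltry.
Qed.

Lemma has_sum_fin_sum (F : int -> R) (s : R) : fin_sum F s ->
  has_sum (fun k => (F k)%:C) s%:C.
Proof.
move=> [A hA]; have tF := @summability.totally_filter int.
apply: cvg_near_cst.
exists A => // B /= AB; rewrite /summability.partial_sum.
rewrite -(big_seq_fsetE _ _ xpredT (fun k => (F k)%:C))/= -rmorph_sum/=.
by rewrite hA.
Qed.

End Transfer.

Theorem theorem2p5 (R : realType) (a b : R) (p q : nat) (e : R) :
  0 < a -> 0 < b -> rationally_independent a b ->
  (0 < p)%N -> (0 < q)%N -> coprime p q ->
  0 < e ->
  exists f : R -> R[i],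
    [/\ lebesgue_measurable_fun f,
        {ae mes R, forall x : R,
          abs_cvg (fun k : int => f (x - k%:~R * a)) /\
          has_sum (fun k : int => f (x - k%:~R * a)) p%:R},
        {ae mes R, forall x : R,
          abs_cvg (fun k : int => f (x - k%:~R * b)) /\
          has_sum (fun k : int => f (x - k%:~R * b)) q%:R}
      & (mes R (supp f) < (a + b - Num.min (a / q%:R) (b / p%:R) + e)%:E)%E].
Proof.
move=> a0 b0 ind p0 q0 _ e0.
have [f [mf ta tb fS]] := step_tiling a0 b0 ind p0 q0 e0.
have cvg c (n : nat) : tiles c f (fun=> n%:R) -> forall x,
    abs_cvg (fun k : int => (f (x - k%:~R * c))%:C) /\
    has_sum (fun k : int => (f (x - k%:~R * c))%:C) n%:R.
  move=> tc x; split; first exact: abs_cvg_fin_sum (tc x).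
  by rewrite -(rmorph_nat (real_complex R)); exact: has_sum_fin_sum (tc x).
exists (fun x => (f x)%:C); split.
- exact: lebesgue_measurable_real_complex.
- exact/aeW/cvg.
- exact/aeW/cvg.
rewrite (_ : supp _ = [set x | f x != 0])//.
by apply/seteqP; split => x; rewrite /supp /= fmorph_eq0.
Qed.
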